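(* Let $\mathcal H=\mathcal H_1\otimes\cdots\otimes\mathcal H_m$ be a tensor product of $m$ finite-dimensional complex Hilbert spaces with $\dim\mathcal H=d$, let $1\le k\le m$ and $n=m-k+1$, and let $\eta_m=\{p_b,\rho_b\}_b$ be any finite ensemble of $m$-partite density operators on $\mathcal H$. Let $\epsilon_{\eta_m}=\{p_b,\sigma_b\}_b$ be the closest ensemble of $(m-n+1)$-separable states to $\eta_m$, and let $\mathbb R_n^M(\eta_m)=\max_b R_n(\rho_b\|\tfrac{I_d}{d})$ be the maximum random robustness of $n$-entanglement of $\eta_m$. Then for every discrimination scheme $X$, $$P_X(\eta_m)\le P_X(\epsilon_{\eta_m})\left[1+\mathbb R_n^M(\eta_m)\right].$$
   Context: Ensembles: an ensemble $\{p_b,\rho_b\}_b$ consists of finitely many density operators $\rho_b$ on $\mathcal H$ with $p_b\ge 0$, $\sum_b p_b=1$. $k$-separability: a pure state of $\mathcal H$ is $k$-separable if it is a tensor product of $k$ pure states (each belonging to one block of some partition of the $m$ parties into $k$ nonempty blocks). A density operator on $\mathcal H$ is $k$-separable if it is a convex mixture of $k$-separable pure states (the partition may vary between the terms). The set of $k$-separable density operators is $\mathcal M_k$. Throughout $n=m-k+1$, i.e. $k=m-n+1$. Random robustness of $n$-entanglement: for a density operator $\rho$ on $\mathcal H$, $R_n(\rho\|\tfrac{I_d}{d})$ is the minimum $r\ge 0$ such that $\frac{\rho+r I_d/d}{1+r}\in\mathcal M_k$, where $I_d$ is the identity on $\mathcal H$. This minimum is finite. Closest $k$-separable ensemble: for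 $\eta_m=\{p_b,\rho_b\}_b$, write $\boldsymbol R_b=R_n(\rho_b\|\tfrac{I_d}{d})$ and $\sigma_b=\frac{\rho_b+\boldsymbol R_b I_d/d}{1+\boldsymbol R_b}$; then $\epsilon_{\eta_m}=\{p_b,\sigma_b\}_b$ (same probabilities). Discrimination schemes: a discrimination scheme $X$ is specified by a nonempty set $\boldsymbol X$ of allowed POVMs $\{M_b\}_b$ on $\mathcal H$ (so $M_b\ge 0$, $\sum_b M_b=I_d$), with outcomes indexed by the same index set as the ensemble (outcome $b$ means guessing the state with index $b$); examples are all POVMs (global), local operations, or LOCC. The optimal success probability for an ensemble $\{p_b,\tau_b\}_b$ is $P_X(\{p_b,\tau_b\}_b)=\max_{\{M_b\}\in\boldsymbol X}\sum_b p_b\operatorname{Tr}[M_b\tau_b]$ (read as a supremum if the maximum is not attained). *)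

(* Defs.v *)
From HB Require Import structures.
From mathcomp Require Import all_boot all_order all_algebra.
From mathcomp Require Import all_classical reals.
From mathcomp Require Import complex.

Set Implicit Arguments.
Unset Strict Implicit.
Unset Printing Implicit Defensive.

Import Order.TTheory GRing.Theory Num.Theory.

Local Open Scope ring_scope.
Local Open Scope complex_scope.
Local Open Scope sesquilinear_scope.

(* [0 <= z] in R[i] says that z is real and nonnegative, so this condition
   forces A to be Hermitian. *)
Definition psd (R : realType) (d : nat) (A : 'M[R[i]]_d) : Prop :=
  forall v : 'cV[R[i]]_d, 0 <= (v^t* *m A *m v) 0 0.

Definition density (R : realType) (d : nat) (rho : 'M[R[i]]_d) : Prop :=
  psd rho /\ \tr rho = 1.

Definition unit_vector (R : realType) (d : nat) (v : 'cV[R[i]]_d) : Prop :=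
  (v^t* *m v) 0 0 = 1.

Definition pure_op (R : realType) (d : nat) (v : 'cV[R[i]]_d) : 'M[R[i]]_d :=
  v *m v^t*.

Definition maxmixed (R : realType) (d : nat) : 'M[R[i]]_d := d%:R^-1%:M.

Definition distribution (R : realType) (I : finType) (p : I -> R) : Prop :=
  (forall b, 0 <= p b) /\ \sum_b p b = 1.

Definition ensemble (R : realType) (I : finType) (d : nat)
    (p : I -> R) (rho : I -> 'M[R[i]]_d) : Prop :=
  distribution p /\ forall b, density (rho b).

Definition povm (R : realType) (I : finType) (d : nat)
    (M : I -> 'M[R[i]]_d) : Prop :=
  (forall b, psd (M b)) /\ \sum_b M b = 1%:M.

Definition scheme (R : realType) (I : finType) (d : nat)
    (X : set (I -> 'M[R[i]]_d)) : Prop :=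
  (X !=set0)%classic /\ forall M, X M -> povm M.

(* \tr (M b *m tau b) is a real element of R[i] when M b and tau b are positive
   semidefinite; [Re] only changes its type to R. *)
Definition success (R : realType) (I : finType) (d : nat)
    (p : I -> R) (tau M : I -> 'M[R[i]]_d) : R :=
  \sum_b p b * complex.Re (\tr (M b *m tau b)).

Definition opt_success (R : realType) (I : finType) (d : nat)
    (X : set (I -> 'M[R[i]]_d)) (p : I -> R) (tau : I -> 'M[R[i]]_d) : R :=
  sup [set success p tau M | M in X]%classic.

(* Party i carries C^(dims i) with its standard basis.  A set B of parties
   carries the tensor product of these spaces over i in B, whose standard basis
   is indexed by the families of local basis labels (j_i)_(i in B). *)
Definition block_idx (m : nat) (dims : 'I_m -> nat) (B : {set 'I_m}) : finType :=
  {dffun forall i : {i : 'I_m | i \in B}, 'I_(dims (val i))}.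

Definition full_idx (m : nat) (dims : 'I_m -> nat) : finType :=
  {dffun forall i : 'I_m, 'I_(dims i)}.

Definition restrict_idx (m : nat) (dims : 'I_m -> nat) (B : {set 'I_m})
    (j : full_idx dims) : block_idx dims B :=
  [ffun i : {i : 'I_m | i \in B} => j (val i)].

Definition block_dim (m : nat) (dims : 'I_m -> nat) (B : {set 'I_m}) : nat :=
  #|block_idx dims B|.

Definition full_dim (m : nat) (dims : 'I_m -> nat) : nat := #|full_idx dims|.

Lemma full_dimE (m : nat) (dims : 'I_m -> nat) :
  full_dim dims = (\prod_i dims i)%N.
Proof.
rewrite /full_dim card_dep_ffun foldrE big_map big_enum /=.
by apply: eq_bigr => i _; rewrite card_ord.
Qed.

(* The tensor product over the blocks B of P of the vectors phi B: its
   coordinate at a multi-index j is the product over B of the coordinates of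
   phi B at j restricted to B. *)
Definition tensor_blocks (R : realType) (m : nat) (dims : 'I_m -> nat)
    (P : {set {set 'I_m}})
    (phi : forall B : {set 'I_m}, 'cV[R[i]]_(block_dim dims B)) :
    'cV[R[i]]_(full_dim dims) :=
  \col_a \prod_(B in P) phi B (enum_rank (restrict_idx B (enum_val a))) 0.

(* MathComp's [finset.partition] requires the blocks to be nonempty. *)
Definition ksep_vector (R : realType) (m : nat) (dims : 'I_m -> nat) (k : nat)
    (psi : 'cV[R[i]]_(full_dim dims)) : Prop :=
  exists (P : {set {set 'I_m}})
    (phi : forall B : {set 'I_m}, 'cV[R[i]]_(block_dim dims B)),
    [/\ finset.partition P [set: 'I_m], #|P| = k,
        forall B, B \in P -> unit_vector (phi B)
      & psi = tensor_blocks P phi].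

Definition ksep (R : realType) (m : nat) (dims : 'I_m -> nat) (k : nat)
    (rho : 'M[R[i]]_(full_dim dims)) : Prop :=
  exists (N : nat) (q : 'I_N -> R) (psi : 'I_N -> 'cV[R[i]]_(full_dim dims)),
    [/\ distribution q, forall t, ksep_vector k (psi t)
      & rho = \sum_t (q t)%:C *: pure_op (psi t)].

Definition mix (R : realType) (d : nat) (rho tau : 'M[R[i]]_d) (r : R) :
    'M[R[i]]_d :=
  ((1 + r)^-1)%:C *: (rho + r%:C *: tau).

(* For 0 < n <= m, tau = maxmixed and rho a density operator this set of reals
   is nonempty and has a least element, which [inf] then returns. *)
Definition robustness (R : realType) (m : nat) (dims : 'I_m -> nat) (n : nat)
    (rho tau : 'M[R[i]]_(full_dim dims)) : R :=
  inf [set r : R | 0 <= r /\ ksep (m - n + 1) (mix rho tau r)]%classic.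

Definition random_robustness (R : realType) (m : nat) (dims : 'I_m -> nat)
    (n : nat) (rho : 'M[R[i]]_(full_dim dims)) : R :=
  robustness n rho (maxmixed R (full_dim dims)).

Definition closest_states (R : realType) (m : nat) (dims : 'I_m -> nat)
    (n : nat) (I : finType) (rho : I -> 'M[R[i]]_(full_dim dims)) (b : I) :
    'M[R[i]]_(full_dim dims) :=
  mix (rho b) (maxmixed R (full_dim dims)) (random_robustness n (rho b)).

(* Robustnesses are nonnegative, so the base value 0 is harmless. *)
Definition max_random_robustness (R : realType) (m : nat) (dims : 'I_m -> nat)
    (n : nat) (I : finType) (rho : I -> 'M[R[i]]_(full_dim dims)) : R :=
  \big[Num.max/0]_b random_robustness n (rho b).

(* Main.v *)
(* For a positive semidefinite M_b, the identity
   (1 + R_b) sigma_b = rho_b + R_b I/d and Tr[M_b] >= 0 give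
   Tr[M_b rho_b] <= (1 + R_b) Tr[M_b sigma_b], where R_b is at most the maximal
   robustness; sum over b and take suprema over the scheme.  The supremum for
   sigma is a genuine one because Tr[M_b sigma_b] <= Tr[sigma_b], by the
   positivity of the trace of a product of two positive semidefinite matrices. *)
Require Import Defs.
From mathcomp Require Import all_boot all_order all_algebra.
From mathcomp Require Import all_classical reals.
From mathcomp Require Import complex.

Import Order.TTheory GRing.Theory Num.Theory.

Local Open Scope ring_scope.
Local Open Scope complex_scope.
Local Open Scope sesquilinear_scope.

(** Polarization: the form is tested on the vectors [e_i + c e_j] with [c] equal to 0, 1 and
    ['i]. *)
Lemma quadratic_form_eq0 (C : numClosedFieldType) (d : nat) (D : 'M[C]_d) :
  (forall v : 'cV[C]_d, (v^t* *m D *m v) 0 0 = 0) -> D = 0.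
Proof.
move=> D0.
pose B (i j : 'I_d) :=
  ((delta_mx i 0 : 'cV[C]_d)^t* *m D *m (delta_mx j 0 : 'cV[C]_d)) 0 0.
have BE i j : B i j = D i j.
  by rewrite /B trmx_delta map_delta_mx -rowE -colE !mxE.
have polar i j (c : C) :
    D i i + c * D i j + Num.conj c * D j i + (Num.conj c * c) * D j j = 0.
  rewrite -[RHS](D0 (delta_mx i 0 + c *: delta_mx j 0)) -!BE /B.
  have trE (u w : 'cV[C]_d) : (u + c *: w)^t* = u^t* + Num.conj c *: w^t*.
    by apply/matrixP => x y; rewrite !mxE rmorphD rmorphM.
  rewrite trE !mulmxDl !mulmxDr -!scalemxAl -!scalemxAr.
  do 4! move: (_ *m D *m delta_mx _ _) => ?.
  by rewrite !mxE !mulrA !addrA.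
have Dii i : D i i = 0.
  by have := polar i i 0; rewrite conjC0 !mul0r !addr0.
apply/matrixP => i j; rewrite [RHS]mxE.
(* With the diagonal zero, [c = 'i] gives [D i j = D j i] and [c = 1] gives [D i j + D j i = 0], so
   [D i j] doubled vanishes. *)
have := polar i j 1; have := polar i j 'i%R.
rewrite conjC1 conjCi !Dii !mulr0 !add0r !addr0 !mul1r mulNr -mulrBr => /eqP.
rewrite mulf_eq0 (negPf (neq0Ci C)) /= subr_eq0 => /eqP <- /eqP.
by rewrite -mulr2n mulrn_eq0 /= => /eqP.
Qed.

(** Each value of the form of [A] is real, hence equals its conjugate, the value of the form of
    [A^t*]; so the form of [A - A^t*] vanishes. *)
Lemma psd_hermitian (R : realType) (d : nat) (A : 'M[R[i]]_d) :
  psd A -> A \is hermsymmx.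
Proof.
move=> A_ge0; apply/is_hermitianmxP; rewrite expr0 scale1r.
apply/eqP; rewrite -subr_eq0; apply/eqP/quadratic_form_eq0 => v.
have /CrealP : (v^t* *m A *m v) 0 0 \is Num.real by apply/ger0_real/A_ge0.
have -> : Num.conj ((v^t* *m A *m v) 0 0) = (v^t* *m A^t* *m v) 0 0.
  have -> : v^t* *m A^t* *m v = (v^t* *m A *m v)^t*.
    by rewrite !trmx_mul !map_mxM trmxCK mulmxA.
  by rewrite !mxE.
by move=> vAv; rewrite mulmxBr mulmxBl !mxE in vAv *; rewrite vAv subrr.
Qed.

Lemma psd_conj_diag (R : realType) (d e : nat) (A : 'M[R[i]]_d)
    (P : 'M[R[i]]_(e, d)) i : psd A -> 0 <= (P *m A *m P^t*) i i.
Proof.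
move=> /(_ ((row i P)^t*)); congr (0 <= _).
by rewrite trmxCK -row_mul !mxE; apply: eq_bigr => j _; rewrite !mxE.
Qed.

Lemma mxtrace_mul_psd_ge0 (R : realType) (d : nat) (A B : 'M[R[i]]_d) :
  psd A -> psd B -> 0 <= \tr (A *m B).
Proof.
move=> A_ge0 B_ge0.
have /hermitian_normalmx/orthomx_spectralP := psd_hermitian _ _ _ B_ge0.
set P := spectralmx B; set s := spectral_diag B => BE.
have Pu : P \is unitarymx := spectral_unitarymx B.
have Punit : P \in unitmx := unitarymx_unit Pu.
have s_ge0 i : 0 <= s 0 i.
  have := psd_conj_diag _ _ _ _ P i B_ge0.
  rewrite -invmx_unitary // BE !mulmxA mulmxV // mul1mx mulmxK //.
  by rewrite mxE eqxx mulr1n.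
rewrite BE invmx_unitary // !mulmxA mxtrace_mulC !mulmxA.
apply: sumr_ge0 => i _; rewrite mul_mx_diag mxE.
by rewrite mulr_ge0 // psd_conj_diag.
Qed.

Lemma ler_Re (R : rcfType) (z w : R[i]) :
  z <= w -> complex.Re z <= complex.Re w.
Proof. by rewrite lecE => /andP[]. Qed.

Lemma Re_realM (R : rcfType) (a : R) (z : R[i]) :
  complex.Re (a%:C * z) = a * complex.Re z.
Proof. by case: z => x y /=; rewrite mul0r subr0. Qed.

Lemma psd_maxmixed (R : realType) (d : nat) : psd (maxmixed R d).
Proof.
move=> v; rewrite /maxmixed mul_mx_scalar -scalemxAl mxE.
rewrite mulr_ge0 ?invr_ge0 ?ler0n // mxE sumr_ge0 // => j _.
by rewrite !mxE mulrC mul_conjC_ge0.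
Qed.

Lemma psd_mix (R : realType) (d : nat) (rho tau : 'M[R[i]]_d) (r : R) :
  0 <= r -> psd rho -> psd tau -> psd (mix rho tau r).
Proof.
move=> r_ge0 rho_ge0 tau_ge0 v.
rewrite /mix -scalemxAr -scalemxAl mulmxDr mulmxDl -scalemxAr -scalemxAl !mxE.
rewrite mulr_ge0 ?ler0c ?invr_ge0 ?addr_ge0 ?mulr_ge0 ?ler0c ?ler01 //.
  by have := rho_ge0 v; rewrite mxE.
by have := tau_ge0 v; rewrite mxE.
Qed.

Lemma robustness_ge0 (R : realType) (m : nat) (dims : 'I_m -> nat) (n : nat)
    (rho tau : 'M[R[i]]_(full_dim dims)) : 0 <= robustness n rho tau.
Proof.
rewrite /robustness; set S := (X in inf X).
(* The infimum of the empty set is 0 by convention. *)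
have [-> | S0] := eqVneq S classical_sets.set0; first by rewrite inf0.
by apply: lb_le_inf; [exact/set0P | move=> r []].
Qed.

(** Since the [M c] sum to the identity, [\tr (M b *m tau b)] is one of the nonnegative terms that
    add up to [\tr (tau b)]. *)
Lemma success_le_mxtrace (R : realType) (I : finType) (d : nat) (p : I -> R)
    (tau M : I -> 'M[R[i]]_d) :
  (forall b, 0 <= p b) -> (forall b, psd (tau b)) -> povm M ->
  success p tau M <= \sum_b p b * complex.Re (\tr (tau b)).
Proof.
move=> p_ge0 tau_ge0 [M_ge0 M1]; apply: ler_sum => b _.
rewrite ler_wpM2l // ler_Re // -[tau b in leRHS]mul1mx -M1 mulmx_suml.
rewrite (bigD1 b) //= mxtraceD lerDl raddf_sum /=.
by apply: sumr_ge0 => c _; exact: mxtrace_mul_psd_ge0.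
Qed.

Lemma Re_mxtrace_mul_le_mix (R : realType) (d : nat)
    (M rho tau : 'M[R[i]]_d) (r : R) :
  0 <= r -> psd M -> psd tau ->
  complex.Re (\tr (M *m rho)) <= complex.Re (\tr (M *m mix rho tau r)) * (1 + r).
Proof.
move=> r_ge0 M_ge0 tau_ge0; have r1_gt0 : 0 < 1 + r by rewrite ltr_wpDr.
rewrite /mix -scalemxAr mxtraceZ Re_realM mulrAC mulVf ?gt_eqF // mul1r.
rewrite mulmxDr mxtraceD -scalemxAr mxtraceZ raddfD /= Re_realM lerDl.
by rewrite mulr_ge0 // (ler_Re _ 0) // mxtrace_mul_psd_ge0.
Qed.

Theorem corollary2 (R : realType) (m : nat) (dims : 'I_m -> nat) (k n : nat)
    (hk : (1 <= k <= m)%N) (hn : n = (m - k + 1)%N)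
    (I : finType) (p : I -> R) (rho : I -> 'M[R[i]]_(full_dim dims))
    (heta : ensemble p rho)
    (X : set (I -> 'M[R[i]]_(full_dim dims))) (hX : scheme X) :
  opt_success X p rho <=
  opt_success X p (closest_states n rho) * (1 + max_random_robustness n rho).
Proof.
have [[p_ge0 _] rho_dens] := heta; have [X0 X_povm] := hX.
have r_ge0 b : 0 <= random_robustness n (rho b) by exact: robustness_ge0.
have sigma_ge0 b : psd (closest_states n rho b).
  apply: psd_mix => //; [exact: (rho_dens b).1 | exact: psd_maxmixed].
have success_ub M : X M ->
    success p (closest_states n rho) M <= opt_success X p (closest_states n rho).
  move=> XM; apply: ub_le_sup; last by exists M.
  (* This bound is the same for every measurement in [X]. *)
  exists (\sum_b p b * complex.Re (\tr (closest_states n rho b))).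
  by move=> _ [N XN <-]; apply: success_le_mxtrace => //; exact: X_povm.
have rmax_ge0 : 0 <= max_random_robustness n rho by exact: bigmax_ge_id.
apply: ge_sup => [|_ [M XM <-]].
  by case: X0 => M XM; exists (success p rho M), M.
(* It remains to compare the two ensembles under the same measurement [M], term by term in [b]. *)
apply: (le_trans _ (ler_wpM2r _ (success_ub M XM))); last by rewrite addr_ge0.
have [M_ge0 _] := X_povm M XM.
rewrite mulr_suml; apply: ler_sum => b _; rewrite -mulrA ler_wpM2l //.
apply: le_trans (Re_mxtrace_mul_le_mix _ _ _ (rho b) _ _ (r_ge0 b) (M_ge0 b)
  (psd_maxmixed _ _)) _.
(* Replacing the robustness of [rho b] by the maximum uses that the trace of [M b] against the
   closest state is nonnegative. *)
rewrite ler_wpM2l ?lerD2l ?le_bigmax //.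
exact/(ler_Re _ 0)/(mxtrace_mul_psd_ge0 _ _ _ _ (M_ge0 b) (sigma_ge0 b)).
Qed.
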